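(* Let $q$ be a prime power, let $n\ge3$ and $d\ge2$ be integers with $\mathrm{char}(\mathbb{F}_q)\nmid d$. For $1\le i\le n$ let $h_i\in\mathbb{F}_q[T]$ with $\deg(h_i)=d$, and let $g\in\mathbb{F}_q[X_1,\dots,X_n]$ with $\deg(g)<d$. Let $V_g=\{\mathbf{x}\in\overline{\mathbb{F}}_q^{\,n}: h_1(x_1)+\cdots+h_n(x_n)-g(\mathbf{x})=0\}$ and let $\mathrm{pcl}(V_g)\subset\mathbb{P}^n$ be its projective closure. Then the singular locus of $\mathrm{pcl}(V_g)$ has dimension at most $0$ and $V_g$ is absolutely irreducible.
   Context: $\overline{\mathbb{F}}_q$ is an algebraic closure of $\mathbb{F}_q$, $\mathbb{P}^n$ is projective $n$-space over $\overline{\mathbb{F}}_q$, and $\mathrm{pcl}(V_g)$ is the projective hypersurface defined by the homogenization of $h_1(X_1)+\cdots+h_n(X_n)-g$. Absolutely irreducible means irreducible over $\overline{\mathbb{F}}_q$. *)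

(* Defs.v *)
From HB Require Import structures.
From mathcomp Require Import all_boot all_algebra all_field.
From mathcomp Require Import classical_sets.
From mathcomp Require Import mpoly.

Set Implicit Arguments.
Unset Strict Implicit.
Unset Printing Implicit Defensive.

Import GRing.Theory.
Local Open Scope ring_scope.
Local Open Scope classical_set_scope.

(* A topology on T is given by its family [closed] of closed sets. *)
Section TopologicalDimension.
Variables (T : Type) (closed : set (set T)).

Definition closed_in (X : set T) : set (set T) :=
  [set Z | exists2 C, closed C & Z = X `&` C].

(* Irreducibility for the induced topology; the empty set is not irreducible. *)
Definition irreducible_set (X : set T) : Prop :=
  X !=set0 /\
  forall A B, closed_in X A -> closed_in X B -> X = A `|` B -> X = A \/ X = B.

(* Krull dimension at most k: every chain Z_0 < ... < Z_m of irreducible closed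
   subsets of X has length m <= k.  In particular the empty set satisfies this
   for every k. *)
Definition dim_le (X : set T) (k : nat) : Prop :=
  forall (m : nat) (Z : 'I_m.+1 -> set T),
    (forall i, closed_in X (Z i) /\ irreducible_set (Z i)) ->
    (forall i j : 'I_m.+1, (i < j)%N -> Z i `<` Z j) ->
    (m <= k)%N.

End TopologicalDimension.

Section Geometry.
Variables (K : fieldType) (n : nat).

Definition affine_space := 'rV[K]_n.

Definition affine_zariski_closed : set (set affine_space) :=
  [set Z | exists S : set {mpoly K[n]},
             Z = [set x : affine_space | forall p, S p -> p.@[fun i => x 0 i] = 0]].

(* Projective n-space: the lines through the origin of K^(n+1). *)
Definition proj_space := {L : {vspace 'rV[K]_n.+1} | \dim L == 1%N}.

(* p vanishes on the whole line L; for a homogeneous p this means that p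
   vanishes at one, or at all, of the homogeneous coordinate vectors of L. *)
Definition vanishes_at (p : {mpoly K[n.+1]}) (L : proj_space) : Prop :=
  forall v : 'rV[K]_n.+1, v \in val L -> p.@[fun i => v 0 i] = 0.

Definition proj_zariski_closed : set (set proj_space) :=
  [set Z | exists2 S : set {mpoly K[n.+1]},
             (forall p, S p -> exists e, p \is e.-homog) &
             Z = [set L : proj_space | forall p, S p -> vanishes_at p L]].

(* The variable of index 0 is the homogenizing one, and X_i becomes the
   variable of index i + 1. *)
Definition homogenization (f : {mpoly K[n]}) : {mpoly K[n.+1]} :=
  \sum_(m <- msupp f)
    f@_m *: ('X_ord0 ^+ ((msize f).-1 - mdeg m)
             * \prod_(i < n) 'X_(lift ord0 i) ^+ m i).

Definition proj_hypersurface (G : {mpoly K[n.+1]}) : set proj_space :=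
  [set L : proj_space | vanishes_at G L].

(* Jacobian criterion, applied to the defining equation G. *)
Definition singular_locus (G : {mpoly K[n.+1]}) : set proj_space :=
  [set L : proj_space | proj_hypersurface G L /\ forall i, vanishes_at G^`M(i) L].

End Geometry.

Section DiagonalPerturbation.
Variables (F K : fieldType) (iota : {rmorphism F -> K}) (n : nat).
Variables (h : 'I_n -> {poly F}) (g : {mpoly F[n]}).

(* h_1(X_1) + ... + h_n(X_n) - g *)
Definition Vg_poly : {mpoly F[n]} :=
  \sum_(i < n) (map_poly (@mpolyC n F) (h i)).['X_i] - g.

Definition Vg : set (affine_space K n) :=
  [set x : affine_space K n | \sum_(i < n) (map_poly iota (h i)).[x 0 i]
           - (map_mpoly iota g).@[fun i => x 0 i] = 0].

(* The form over K whose zero locus in projective space is pcl(V_g). *)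
Definition pcl_Vg_poly : {mpoly K[n.+1]} :=
  homogenization (map_mpoly iota Vg_poly).

Lemma VgE : Vg =
  [set x : affine_space K n | (map_mpoly iota Vg_poly).@[fun i => x 0 i] = 0].
Proof.
apply: eq_set => x; rewrite /Vg_poly (rmorphB (map_mpoly iota)) mevalB.
congr (_ - _ = _); pose ev := meval (fun i => x 0 i).
rewrite (rmorph_sum (map_mpoly iota)) (rmorph_sum ev) /=.
apply: eq_bigr => i _.
rewrite !horner_coef size_map_poly size_map_inj_poly //; last first.
  exact: can_inj (@mpolyCK n F).
rewrite (rmorph_sum (map_mpoly iota)) (rmorph_sum ev) /=.
apply: eq_bigr => j _; rewrite coef_map /= coef_map_id0 ?mpolyC0 //.
rewrite (rmorphM (map_mpoly iota)) (rmorphM ev) (rmorphXn (map_mpoly iota)).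
by rewrite (rmorphXn ev) /= map_mpolyC map_mpolyX /ev mevalC mevalXU.
Qed.

End DiagonalPerturbation.

(* Main.v *)
Require Import Defs.
From mathcomp Require Import all_boot all_algebra all_field.
From mathcomp Require Import boolp classical_sets.
From mathcomp Require Import mpoly.

(* Over K the polynomial is f = sum_i a_i X_i^d + f' with deg f' < d and all a_i <> 0.

   At a singular point with X_0 = 0 the partial derivatives of the homogenization reduce to
   d a_i X_i^(d-1), so there is none. At the others, normalized by X_0 = 1, each X_i^(d-1) equals
   a polynomial of degree < d-1; hence on the singular locus every polynomial function is a
   combination of monomials with exponents < d-1, and multiplication by X_i acts on these through
   a matrix whose characteristic polynomial vanishes at X_i. Each coordinate thus takes finitely
   many values, and an irreducible subset of the singular locus is a point.

   For irreducibility, choose z with a_0 z^d + a_1 = 0 and substitute X_0 := z T + X_0, X_1 := T,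
   X_2 := Y. For the weights d of T and d-1 of Y, the top part of f is a_2 Y^d + b T^(d-1) with b
   a nonconstant polynomial in X_0, and a polynomial of degree < d in Y has a single power of Y in
   its top part. As top parts are multiplicative, no multiple c(T) f with c <> 0 is a product of
   two polynomials of degree < d in Y. If p does not vanish on V, its remainder modulo f (which is
   monic in Y up to a constant) is nonzero, and its resultant with f is a nonzero polynomial s_p
   free of Y: p is nonzero at every point of V where s_p is. For two such p and q, a point of V
   with s_p s_q <> 0 then shows that p q does not vanish on V. *)

Set Implicit Arguments.
Unset Strict Implicit.
Unset Printing Implicit Defensive.

Import GRing.Theory.
Local Open Scope ring_scope.

(** * Morphisms from multivariate polynomials and points of nonvanishing *)

Lemma rmorph_mpolyE (n : nat) (R : nzRingType) (S : comNzRingType)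
    (f : {rmorphism {mpoly R[n]} -> S}) (p : {mpoly R[n]}) :
  f p = mmap (fun c => f c%:MP) (fun i => f 'X_i) p.
Proof.
rewrite {1}[p]mpolyE rmorph_sum; apply: eq_bigr => m _.
rewrite -mul_mpolyC rmorphM mpolyXE_id rmorph_prod; congr (_ * _).
by apply: eq_bigr => i _; rewrite rmorphXn.
Qed.

Lemma eq_mpoly_rmorph (n : nat) (R : nzRingType) (S : comNzRingType)
    (f g : {rmorphism {mpoly R[n]} -> S}) :
  (forall c, f c%:MP = g c%:MP) -> (forall i, f 'X_i = g 'X_i) -> f =1 g.
Proof.
move=> eqC eqX p; rewrite !rmorph_mpolyE; apply: eq_bigr => m _.
by rewrite eqC; congr (_ * _); apply: eq_bigr => i _; rewrite eqX.
Qed.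

(** By induction on n: [muni] reads p as a univariate polynomial in the last variable. The induction
    hypothesis keeps one of its coefficients nonzero at some v, and a closed field contains a
    non-root y of the resulting polynomial. *)
Lemma mpoly_nonvanishing (K : closedFieldType) (n : nat) (p : {mpoly K[n]}) :
  p != 0 -> exists v : 'I_n -> K, p.@[v] != 0.
Proof.
elim: n p => [|n IHn] p p_neq0.
  exists (fun=> 0); have le1: (msize p <= 1)%N.
    rewrite msizeE; apply/bigmax_leqP_seq => m _ _.
    by rewrite mdegE big_ord0.
  move: p_neq0; rewrite (msize1_polyC le1) mevalC; apply: contraNneq => ->.
  by rewrite mpolyC0.
pose w := @widen_ord n n.+1 (leqnSn n).
pose rst (m : 'X_{1..n.+1}) := [multinom m (w i) | i < n].
have [m m_supp]: exists m, m \in msupp p.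
  move: p_neq0; rewrite -msupp_eq0; case: (msupp p) => // m s _.
  by exists m; rewrite mem_head.
(* The coefficient at [rst m] is [p@_m], since a monomial is determined by its restriction and its
   last exponent. *)
have: (muni p)`_(m ord_max) != 0.
  apply: contraTneq m_supp => /(congr1 (mcoeff (rst m))).
  rewrite mcoeff0 muniE coef_sum raddf_sum /= => sum0.
  rewrite mcoeff_msupp negbK -sum0.
  have term m' : ((p@_m' *: 'X_[rst m'] *: 'X^(m' ord_max))`_(m ord_max))@_(rst m)
      = p@_m' * (m' == m)%:R.
    rewrite coefZ coefXn; have [->|neq_mm'] := eqVneq m' m.
      by rewrite !eqxx !mulr1 mcoeffZ mcoeffX eqxx mulr1.
    have [eql|] := eqVneq (m ord_max) (m' ord_max); last by rewrite !mulr0 mcoeff0.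
    rewrite mulr1 mcoeffZ mcoeffX; case: eqP => [/mnmP eqr|//].
    case/eqP: neq_mm'.
    apply/mnmP => i; have [lt_in|le_ni] := ltnP i n.
      have := eqr (Ordinal lt_in); rewrite !mnmE.
      by have -> : w (Ordinal lt_in) = i by apply: val_inj.
    have -> : i = ord_max; last by [].
    by apply/val_inj/eqP; rewrite eqn_leq le_ni -ltnS ltn_ord.
  rewrite (eq_bigr _ (fun m' _ => term m')).
  have [m_p|m_p] := boolP (m \in msupp p).
    rewrite (bigD1_seq m) ?msupp_uniq //= eqxx mulr1 big1 ?addr0 // => m' /negPf->.
    by rewrite mulr0.
  rewrite (memN_msupp_eq0 m_p) big1_seq // => m' /= m'_p.
  by case: eqP m'_p m_p => [->->|]; rewrite ?mulr0.
case/IHn => v v_neq0.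
have: map_poly (meval v) (muni p) != 0.
  by apply: contraNneq v_neq0 => /(congr1 (coefp (m ord_max))); rewrite /= coef_map coef0 => ->.
case/closed_nonrootP => y; rewrite /root => y_neq0.
exists (fun i => if unlift ord_max i is Some j then v j else y).
set v' := fun i => _; apply: contraNneq y_neq0 => p0.
have -> : (map_poly (meval v) (muni p)).[y]
    = (horner_eval y \o map_poly (meval v) \o @muni n K) p by [].
rewrite (@eq_mpoly_rmorph _ _ _ _ (meval v')) => [|c|i]; first exact/eqP.
  by rewrite /= muniC map_polyC /= mevalC /horner_eval hornerC mevalC.
rewrite /= mevalXU /v' /muni mmapX mmap1U.
case: unliftP => [j ->|->].
  case: splitP => [k /= eq_k|k].
    rewrite map_polyC /= mevalXU /horner_eval hornerC; congr (v _).
    by apply: val_inj; rewrite /= -eq_k /= /bump leqNgt ltn_ord.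
  move/eqP; rewrite /= /bump leqNgt ltn_ord /= add0n => /eqP E.
  by have := ltn_ord j; rewrite E -[X in (_ < X)%N]addn0 ltn_add2l.
case: splitP => [k /= eq_k|k _]; first by have := ltn_ord k; rewrite -eq_k ltnn.
by rewrite map_polyX /horner_eval hornerX.
Qed.

(** * Top coefficients relative to a degree bound *)

(** Here k only bounds the degree and c may be 0, so the relation passes to sums whose leading terms
    cancel. *)
Definition has_top (S : nzRingType) (k : nat) (c : S) (p : {poly S}) : Prop :=
  (size p <= k.+1)%N /\ p`_k = c.

Lemma has_top0 (S : nzRingType) k : has_top (S := S) k 0 0.
Proof. by rewrite /has_top size_poly0 coef0. Qed.

Lemma has_topC (S : nzRingType) (c : S) : has_top 0 c c%:P.
Proof. by rewrite /has_top size_polyC coefC; case: eqP. Qed.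

Lemma has_top_small (S : nzRingType) k (p : {poly S}) :
  (size p <= k)%N -> has_top k 0 p.
Proof. by move=> le_pk; split; [apply: leqW | rewrite nth_default]. Qed.

Lemma has_top_size (S : nzRingType) k (c : S) p :
  c != 0 -> has_top k c p -> size p = k.+1 /\ lead_coef p = c.
Proof.
move=> c_neq0 [le_pk coef_p]; have size_p : size p = k.+1.
  apply/eqP; rewrite eqn_leq le_pk ltnNge; apply: contraNN c_neq0 => le_kp.
  by rewrite -coef_p nth_default.
by rewrite lead_coefE size_p.
Qed.

Lemma has_topD (S : nzRingType) k (c1 c2 : S) p1 p2 :
  has_top k c1 p1 -> has_top k c2 p2 -> has_top k (c1 + c2) (p1 + p2).
Proof.
move=> [s1 <-] [s2 <-]; split; last by rewrite coefD.
by rewrite (leq_trans (size_polyD _ _)) // geq_max s1.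
Qed.

Lemma has_topMn (S : nzRingType) k (c : S) p m :
  has_top k c p -> has_top k (c *+ m) (p *+ m).
Proof.
move=> top_p; elim: m => [|m IHm]; first by rewrite !mulr0n; apply: has_top0.
by rewrite !mulrSr; apply: has_topD.
Qed.

Lemma has_topM (S : nzRingType) k1 k2 (c1 c2 : S) p1 p2 :
  has_top k1 c1 p1 -> has_top k2 c2 p2 ->
  has_top (k1 + k2) (c1 * c2) (p1 * p2).
Proof.
move=> [s1 <-] [s2 <-]; split.
  rewrite (leq_trans (size_polyMleq _ _)) // -subn1 leq_subLR add1n.
  by rewrite -addnS -addSn leq_add.
have lt1 : (k1 < (k1 + k2).+1)%N by rewrite ltnS leq_addr.
rewrite coefM (bigD1 (Ordinal lt1)) //= addKn big1 ?addr0 // => i.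
rewrite -val_eqE /= neq_ltn => /orP[lt_i|gt_i].
  by rewrite [p2`__]nth_default ?mulr0 // (leq_trans s2) // ltn_subRL ltn_add2r.
by rewrite [p1`__]nth_default ?mul0r // (leq_trans s1).
Qed.

Lemma has_topX (S : nzRingType) k (c : S) p e :
  has_top k c p -> has_top (k * e) (c ^+ e) (p ^+ e).
Proof.
move=> top_p; elim: e => [|e IHe]; first by rewrite muln0 !expr0; apply: has_topC.
by rewrite mulnS !exprS; apply: has_topM.
Qed.

Lemma has_top_sum (S : nzRingType) k (I : Type) (r : seq I) (P : pred I)
    (c : I -> S) (p : I -> {poly S}) :
  (forall i, P i -> has_top k (c i) (p i)) ->
  has_top k (\sum_(i <- r | P i) c i) (\sum_(i <- r | P i) p i).
Proof.
move=> top; apply: (big_ind2 (has_top k)) => //; first exact: has_top0.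
by move=> *; apply: has_topD.
Qed.

Lemma has_top_mmap1 (S : nzRingType) (n k : nat) (c : 'I_n -> S)
    (h : 'I_n -> {poly S}) (m : 'X_{1..n}) :
  (forall i, has_top k (c i) (h i)) ->
  has_top (k * mdeg m) (mmap1 c m) (mmap1 h m).
Proof.
move=> top_h; rewrite mdegE big_distrr /mmap1 /=.
elim/big_rec3: _ => [|i k' p' c' _ top']; first exact: has_topC.
by apply: has_topM => //; apply: has_topX.
Qed.

(** Only monomials of degree exactly e can reach degree k e. The coefficient comes from K itself, so
    the lower-order part f' will contribute a mere constant to the weighted top part. *)
Lemma has_top_mmap (K : nzRingType) (S : comNzRingType) (f : {rmorphism K -> S})
    (n k e : nat) (c : 'I_n -> K) (h : 'I_n -> {poly S}) (p : {mpoly K[n]}) :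
    (0 < k)%N -> (msize p <= e.+1)%N ->
    (forall i, has_top k (f (c i)) (h i)) ->
  exists a : K, has_top (k * e) (f a) (mmap (polyC \o f) h p).
Proof.
move=> k_gt0 le_pe top_h.
exists (\sum_(m <- msupp p) if mdeg m == e then p@_m * mmap1 c m else 0).
rewrite rmorph_sum /mmap !big_seq; apply: has_top_sum => m /msize_mdeg_lt lt_m.
have top_m : has_top (k * mdeg m) (f (p@_m * mmap1 c m)) ((f p@_m)%:P * mmap1 h m).
  rewrite rmorphM -[(k * _)%N]add0n; apply: has_topM; first exact: has_topC.
  suff <- : mmap1 (f \o c) m = f (mmap1 c m) by apply: has_top_mmap1.
  by rewrite rmorph_prod; apply: eq_bigr => i _; rewrite rmorphXn.
have [<- //|neq_me] := eqVneq (mdeg m) e.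
rewrite rmorph0; apply: has_top_small; case: top_m => [le_s _].
rewrite (leq_trans le_s) // ltn_mul2l k_gt0 ltn_neqAle neq_me.
by rewrite -ltnS (leq_trans lt_m).
Qed.

(** In the binomial expansion p^d cancels, the term d p^(d-1) u gives the top, and the later terms
    contain smaller powers of p. *)
Lemma has_top_expD_sub (S : comNzRingType) (k d : nat) (c u : S) (p : {poly S}) :
    (0 < k)%N -> (0 < d)%N -> has_top k c p ->
  has_top (k * d.-1) (c ^+ d.-1 * u *+ d) ((p + u%:P) ^+ d - p ^+ d).
Proof.
move=> k_gt0; case: d => // d _ top_p; rewrite exprDn big_ord_recl big_ord_recl /=.
rewrite subn0 expr0 mulr1 bin0 mulr1n addrAC subrr add0r.
rewrite bin1 subSS subn0 expr1 -[X in has_top _ X _]addr0.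
apply: has_topD.
  apply: has_topMn; rewrite -[(k * d)%N]addn0.
  by apply: has_topM (has_topC _); apply: has_topX.
apply: has_top_small; rewrite (leq_trans (size_sum _ _ _)) //.
apply/bigmax_leqP => i _; rewrite -polyC_exp /bump !leq0n !add1n subSS.
set m := binomial _ _.
have [le_s _] : has_top (k * (d - i.+1) + 0) (c ^+ (d - i.+1) * u ^+ i.+2 *+ m)
    (p ^+ (d - i.+1) * (u ^+ i.+2)%:P *+ m).
  by apply: has_topMn; apply: has_topM (has_topC _); apply: has_topX.
rewrite (leq_trans le_s) // addn0 ltn_mul2l k_gt0.
by rewrite ltn_subrL /= (leq_trans _ (ltn_ord i)).
Qed.

(** * Top parts for the weights d and d-1 *)

(* T := S^d, Y := Z S^(d-1), from polynomials in Y over R[T] to polynomials in S over R[Z]. *)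
Definition weight_subst (R : comNzRingType) (d : nat) (g : {poly {poly R}}) :
    {poly {poly R}} :=
  (map_poly (fun c => map_poly polyC c \Po 'X^d) g).['X%:P * 'X^(d.-1)].

Lemma weight_substM (R : comNzRingType) d :
  {morph @weight_subst R d : g h / g * h}.
Proof.
move=> g h; rewrite /weight_subst.
by rewrite (rmorphM (map_poly (comp_poly 'X^d \o map_poly polyC))) hornerM.
Qed.

(* The term T^i Y^j has S-degree d i + (d-1) j, which is -j modulo d: distinct j < d never
   compete for the leading term. *)
Lemma weight_subst_lead_coef (R : idomainType) (d : nat) (g : {poly {poly R}}) :
    (0 < d)%N -> g != 0 -> (size g <= d)%N ->
  exists c j, c != 0 /\ lead_coef (weight_subst d g) = c *: 'X^j.
Proof.
move=> d_gt0 g_neq0 le_gd.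
pose w j := ((size (g`_j)%R).-1 * d + d.-1 * j)%N.
pose t j := (map_poly polyC g`_j \Po 'X^d) * ('X%:P * 'X^(d.-1)) ^+ j.
have gE : weight_subst d g = \sum_(j < size g) t j.
  rewrite /weight_subst horner_coef size_map_inj_poly; last first.
  - by rewrite !raddf0.
  - apply: inj_comp; last exact: map_inj_poly (@polyC_inj _) (raddf0 _).
    move=> p q /eqP; rewrite -subr_eq0 -rmorphB /= comp_poly_eq0 ?size_polyXn //.
    by rewrite subr_eq0 => /eqP.
  by apply: eq_bigr => j _; rewrite coef_map_id0 // !raddf0.
have tE (j : nat) : g`_j != 0 ->
    lead_coef (t j) = lead_coef g`_j *: 'X^j /\ size (t j) = (w j).+1.
  move=> gj_neq0.
  have comp_neq0 : map_poly polyC g`_j \Po 'X^d != 0.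
    by rewrite comp_poly_eq0 ?size_polyXn // map_polyC_eq0.
  have YjE : ('X%:P * 'X^(d.-1) : {poly {poly R}}) ^+ j = 'X^j *: 'X^(d.-1 * j).
    by rewrite exprMn -polyC_exp mul_polyC exprM.
  rewrite /t YjE -scalerAr; split.
    rewrite lead_coefZ lead_coefM lead_coef_comp ?size_polyXn // !lead_coefXn.
    rewrite expr1n !mulr1 lead_coef_map_inj ?raddf0 //; last exact: polyC_inj.
    by rewrite mulrC mul_polyC.
  rewrite size_scale ?monic_neq0 ?monicXn //.
  rewrite (size_mul comp_neq0 (monic_neq0 (monicXn _ _))) size_polyXn addnS /=.
  rewrite (polySpred comp_neq0) size_comp_poly size_polyXn.
  by rewrite size_map_inj_poly //; exact: polyC_inj.
have w_inj j k : (j < d)%N -> (k < d)%N -> w j = w k -> j = k.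
  move=> lt_jd lt_kd eq_w.
  have wE i : (w i + i = ((size (g`_i)%R).-1 + i) * d)%N.
    by rewrite /w -addnA -mulSnr (prednK d_gt0) mulnDl [(d * _)%N]mulnC.
  rewrite -(modn_small lt_jd) -(modn_small lt_kd).
  rewrite -(modnMDl ((size (g`_k)%R).-1 + k)) -wE -eq_w.
  by rewrite -[RHS](modnMDl ((size (g`_j)%R).-1 + j)) -wE addnAC.
have lt_last : ((size g).-1 < size g)%N by rewrite prednK // size_poly_gt0.
pose P (j : 'I_(size g)) := g`_j != 0.
have P0 : P (Ordinal lt_last) by rewrite /P /= -lead_coefE lead_coef_eq0.
case: (@arg_maxnP _ (Ordinal lt_last) P (fun j => w j) P0) => j Pj j_max.
have [lead_tj size_tj] := tE j Pj.
exists (lead_coef g`_j), j; split; first by rewrite lead_coef_eq0.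
rewrite gE (bigD1 j) //= lead_coefDl // size_tj ltnS.
rewrite (leq_trans (size_sum _ _ _)) //; apply/bigmax_leqP => k neq_kj.
have [gk0|gk_neq0] := eqVneq g`_k 0.
  by rewrite /t gk0 !raddf0 mul0r size_poly0.
have [_ ->] := tE k gk_neq0; rewrite ltn_neqAle.
have -> : (w k <= w j)%N := j_max k gk_neq0; rewrite andbT.
apply: contraNneq neq_kj => eq_w; apply/eqP/val_inj.
by apply: w_inj eq_w; apply: leq_trans le_gd.
Qed.

(** The images of g, h and c have monomials in Z as leading coefficients, whereas that of F has the
    two terms a Z^d and b. A monomial times the latter is not a monomial. *)
Lemma weight_subst_irreducible (R : idomainType) (d N : nat) (a b : R)
    (F g h : {poly {poly R}}) (c : {poly R}) :
    (0 < d)%N -> a != 0 -> b != 0 -> c != 0 ->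
    has_top N (a *: 'X^d + b%:P) (weight_subst d F) ->
    (size g <= d)%N -> (size h <= d)%N -> c%:P * F <> g * h.
Proof.
move=> d_gt0 a_neq0 b_neq0 c_neq0 top_F le_gd le_hd eqF.
have top_neq0 : a *: 'X^d + b%:P != 0.
  apply: contraNneq b_neq0 => /(congr1 (coefp 0%N)) /=.
  by rewrite coefD coefZ coefXn coefC coef0 eq_sym (gtn_eqF d_gt0) mulr0 add0r => ->.
have [_ leadF] := has_top_size top_neq0 top_F.
have F_neq0 : F != 0.
  apply: contraNneq top_neq0 => F0; rewrite -leadF F0 /weight_subst map_poly0.
  by rewrite horner0 lead_coef0.
have: g * h != 0 by rewrite -eqF mulf_neq0 // polyC_eq0.
rewrite mulf_eq0 negb_or => /andP[g_neq0 h_neq0].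
have size1 : (size c%:P <= d)%N by rewrite size_polyC c_neq0.
have cP_neq0 : c%:P != 0 :> {poly {poly R}} by rewrite polyC_eq0.
have [cg [j [cg_neq0 leadg]]] := weight_subst_lead_coef d_gt0 g_neq0 le_gd.
have [ch [k [ch_neq0 leadh]]] := weight_subst_lead_coef d_gt0 h_neq0 le_hd.
have [cc [l [cc_neq0 leadc]]] := weight_subst_lead_coef d_gt0 cP_neq0 size1.
have := congr1 (lead_coef \o weight_subst d) eqF.
rewrite /= !weight_substM !lead_coefM leadF leadg leadh leadc.
rewrite -!scalerAl -!scalerAr -exprD mulrDr -scalerAr -exprD scalerDr scalerA.
rewrite [_ * b%:P]mulrC mul_polyC !scalerA => eqL.
(* On the left both Z^l and Z^(l+d) occur; on the right only Z^(j+k) does. *)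
have := congr1 (coefp l) eqL; have := congr1 (coefp (l + d)%N) eqL.
rewrite /= !coefD !coefZ !coefXn !eqxx.
have ld : (l + d == l)%N = false by rewrite -{2}[l]addn0 eqn_add2l (gtn_eqF d_gt0).
rewrite ld [(l == _)%N]eq_sym ld !mulr0 !mulr1 addr0 add0r.
have [<-|_] := eqVneq (l + d)%N (j + k)%N; last first.
  by rewrite mulr0 => /eqP; rewrite mulf_eq0 (negPf cc_neq0) (negPf a_neq0).
rewrite [(l == _)%N]eq_sym ld mulr0 => _ /eqP.
by rewrite mulf_eq0 (negPf cc_neq0) (negPf b_neq0).
Qed.

(** For nonconstant r the resultant of F and r serves as s. If it vanished, the gcd would be
    nonconstant of degree at most deg r < d; its cofactor would then also have degree < d, and
    pseudo-division would give the excluded factorization of a multiple c F. *)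
Lemma constant_in_ideal (A : idomainType) (d : nat) (F r : {poly A}) :
    (0 < d)%N -> size F = d.+1 -> r != 0 -> (size r <= d)%N ->
    (forall (c : A) (g h : {poly A}), c != 0 -> (size g <= d)%N -> (size h <= d)%N ->
      c%:P * F <> g * h) ->
  exists (s : A) (U V : {poly A}), s != 0 /\ s%:P = U * F + V * r.
Proof.
move=> d_gt0 size_F r_neq0 le_rd irrF.
have [le_r1|gt_r1] := leqP (size r) 1.
  exists r`_0, 0, 1; rewrite mul0r add0r mul1r -size1_polyC //; split=> //.
  by apply: contraNneq r_neq0 => r0; rewrite (size1_polyC le_r1) r0.
have gt_F1 : (1 < size F)%N by rewrite size_F.
have [[U V] /= [_ _ eq_res]] := resultant_in_ideal gt_F1 gt_r1.
exists (resultant F r), U, V; split=> //; rewrite resultant_eq0 -leqNgt.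
rewrite leqNgt; apply/negP => gcd_gt1.
have le_gd : (size (gcdp F r) <= d)%N.
  by rewrite (leq_trans _ le_rd) // leq_gcdpr.
have /Pdiv.WeakIdomain.dvdpP[[c h] /= c_neq0 eqF] := dvdp_gcdl F r.
apply: (irrF c (gcdp F r) h c_neq0 le_gd); last by rewrite mul_polyC eqF mulrC.
have : size (h * gcdp F r) = d.+1 by rewrite -eqF size_scale.
have g_neq0 : gcdp F r != 0 by rewrite -size_poly_gt0 ltnW.
have [->|h_neq0] := eqVneq h 0; first by rewrite size_poly0.
rewrite size_mul // -subn1 => /eqP; rewrite -(eqn_add2r 1) subnK; last first.
  by rewrite addn_gt0 (ltnW gcd_gt1) orbT.
by move/eqP; rewrite addSnnS -(leq_add2r 2) => <-; rewrite leq_add2l.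
Qed.

(** * Irreducibility *)

Section DiagonalHypersurface.

Variables (K : closedFieldType) (n d : nat) (a : 'I_n -> K) (f' : {mpoly K[n]}).
Hypotheses (d_ge2 : (2 <= d)%N) (d_neq0 : d%:R != 0 :> K).
Hypotheses (a_neq0 : forall i, a i != 0) (size_f' : (msize f' <= d)%N).

Let f : {mpoly K[n]} := \sum_i a i *: 'X_i ^+ d + f'.

Variables (i0 i1 i2 : 'I_n) (z : K).
Hypotheses (neq10 : i1 != i0) (neq20 : i2 != i0) (neq21 : i2 != i1).
Hypothesis z_root : a i0 * z ^+ d + a i1 = 0.

Let R := {mpoly K[n]}.
Let C : {rmorphism K -> {poly R}} := polyC \o @mpolyC n K.

(** The target ring is left arbitrary so that the substitution into R[T][Y], its weighted form and
    the evaluation at points of K are all instances. *)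
Definition coord_change (S : comNzRingType) (c : K -> S) (v : 'I_n -> S) (t y : S) (i : 'I_n) : S :=
  if i == i0 then c z * t + v i0
  else if i == i1 then t else if i == i2 then y else v i.

Lemma rmorph_coord_change (S T : comNzRingType) (g : {rmorphism S -> T})
    (c : K -> S) (c' : K -> T) (v : 'I_n -> S) (v' : 'I_n -> T) t t' y y' i :
  (forall x, g (c x) = c' x) -> (forall j, g (v j) = v' j) -> g t = t' -> g y = y' ->
  g (coord_change c v t y i) = coord_change c' v' t' y' i.
Proof.
rewrite /coord_change => gc gv <- <-; case: ifP => _.
  by rewrite rmorphD rmorphM gc gv.
by do 2![case: ifP => // _].
Qed.

(** T is the inner variable and Y the outer one, so that sizes measure the degree in Y. *)
Let Phi : {rmorphism {mpoly K[n]} -> {poly {poly R}}} :=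
  mmap (polyC \o C)
    (coord_change (polyC \o C) (fun i => ('X_i)%:P%:P) 'X%:P 'X).

Let ev v t y : {rmorphism {poly {poly R}} -> K} :=
  horner_eval y \o map_poly (horner_eval t \o map_poly (meval v)).

Let evC v t y q : ev v t y q%:P = (map_poly (meval v) q).[t].
Proof. by rewrite /ev /= map_polyC /horner_eval hornerC. Qed.

Let ev_Phi v t y p : ev v t y (Phi p) = p.@[coord_change idfun v t y].
Proof.
rewrite -[LHS]/((ev v t y \o Phi) p); apply: eq_mpoly_rmorph => [c|i].
  by rewrite [LHS]/= mmapC -[LHS]/(ev v t y c%:MP%:P%:P) evC map_polyC hornerC /= !mevalC.
rewrite [RHS]/= mevalXU [LHS]/= mmapX mmap1U.
apply: (rmorph_coord_change (g := ev v t y)) => [x|j||].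
- by rewrite -[LHS]/(ev v t y x%:MP%:P%:P) evC map_polyC hornerC /= mevalC.
- by rewrite evC map_polyC hornerC /= mevalXU.
- by rewrite evC map_polyX hornerX.
- by rewrite /ev /= map_polyX /horner_eval hornerX.
Qed.

Let mmap_f (S : comNzRingType) (g : {rmorphism K -> S}) h :
  mmap g h f = \sum_i g (a i) * h i ^+ d + mmap g h f'.
Proof.
rewrite /f mmapD raddf_sum; congr (_ + _); apply: eq_bigr => i _.
by rewrite /= mmapZ rmorphXn /= mmapX mmap1U.
Qed.

Let d_gt0 : (0 < d)%N. Proof. exact: ltnW. Qed.

(** By the choice of z, the terms of index i0 and i1 add up to a_i0 ((z S^d + u)^d - (z S^d)^d),
    where S is the polynomial variable; [has_top_expD_sub] gives its top. The remaining terms are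
    constant in S, below the top because d (d-1) > 0. *)
Let has_top_diagonal (S : comNzRingType) (g : {rmorphism K -> S})
    (x : 'I_n -> {poly S}) (u y : S) :
    x i0 = (g z)%:P * 'X^d + u%:P -> x i1 = 'X^d -> has_top d.-1 y (x i2) ->
    (forall i, i != i0 -> i != i1 -> i != i2 -> (size (x i ^+ d) <= 1)%N) ->
  has_top (d * d.-1) (g (a i2) * y ^+ d + g (a i0 * z ^+ d.-1) * u *+ d)
    (\sum_i (g (a i))%:P * x i ^+ d).
Proof.
move=> x0 x1 top_x2 x_small.
rewrite (bigD1 i0) // (bigD1 i1) // (bigD1 i2) /=; last by rewrite neq20 neq21.
have -> : (g (a i1))%:P * x i1 ^+ d = - ((g (a i0))%:P * ((g z)%:P * 'X^d) ^+ d).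
  have -> : a i1 = - (a i0 * z ^+ d) by apply/eqP; rewrite -addr_eq0 addrC z_root.
  by rewrite x1 rmorphN polyCN mulNr rmorphM rmorphXn polyCM polyC_exp exprMn mulrA.
rewrite addrA -mulrBr addrC x0; apply: has_topD; last first.
  have top_p0 : has_top d (g z) ((g z)%:P * 'X^d).
    rewrite -[X in has_top _ X]mulr1; apply: (has_topM (has_topC (g z))).
    by split; rewrite ?size_polyXn ?coefXn ?eqxx.
  have := has_topM (has_topC (g (a i0))) (has_top_expD_sub u d_gt0 d_gt0 top_p0).
  by rewrite add0n -mulrnAr mulrA -rmorphXn -rmorphM mulrnAr.
rewrite -[X in has_top _ X _]addr0; apply: has_topD.
  have := has_topM (has_topC (g (a i2))) (has_topX d top_x2).
  by rewrite add0n mulnC.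
apply: has_top_small; apply: (leq_trans (size_sum _ _ _)); apply/bigmax_leqP => i.
case/andP => /andP[neq_i0 neq_i1] neq_i2.
rewrite mul_polyC (leq_trans (size_scale_leq _ _)) // (leq_trans (x_small i _ _ _)) //.
by rewrite muln_gt0 d_gt0 -subn1 subn_gt0.
Qed.

(** In the plain degree in Y, only the coordinate i2 has positive degree and f' stays below d. Hence
    [Phi f] is monic in Y up to the constant a_i2, which makes division by it possible. *)
Let Phi_top : has_top d (C (a i2)) (Phi f).
Proof.
rewrite [Phi f]mmap_f; set h := coord_change _ _ _ _.
have top_h i : has_top 1 (C (i == i2)%:R) (h i).
  rewrite /h /coord_change; have [->|_] := eqVneq i i0.
    rewrite eq_sym (negPf neq20) rmorph0 -[X in X * _]/((C z)%:P) -polyCM -polyCD.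
    by apply: has_top_small; rewrite size_polyC leq_b1.
  have [->|_] := eqVneq i i1.
    by rewrite eq_sym (negPf neq21) rmorph0; apply: has_top_small; rewrite size_polyC leq_b1.
  case: ifP => _; last by rewrite rmorph0; apply: has_top_small; rewrite size_polyC leq_b1.
  by rewrite rmorph1; split; rewrite ?size_polyX ?coefX.
have [|b [le_s _]] := has_top_mmap (p := f') (e := d.-1) (ltnSn 0) _ top_h.
  by rewrite prednK.
rewrite -[X in has_top _ X _]addr0; apply: has_topD; last first.
  by apply: has_top_small; rewrite (leq_trans le_s) // mul1n prednK.
have -> : C (a i2) = \sum_i C (a i) * C (i == i2)%:R ^+ d.
  rewrite (bigD1 i2) //= eqxx mpolyC1 expr1n mulr1 big1 ?addr0 // => i /negPf->.
  by rewrite mpolyC0 expr0n gtn_eqF ?mulr0.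
apply: has_top_sum => i _.
by have := has_topM (has_topC (C (a i))) (has_topX d (top_h i)); rewrite add0n mul1n.
Qed.

Let weight_h : 'I_n -> {poly {poly R}} :=
  coord_change (polyC \o C) (fun i => ('X_i)%:P%:P) 'X^d ('X%:P * 'X^(d.-1)).

Let weight_subst_Phi p : weight_subst d (Phi p) = mmap (polyC \o C) weight_h p.
Proof.
pose W : {rmorphism {poly {poly R}} -> {poly {poly R}}} :=
  horner_eval ('X%:P * 'X^(d.-1)) \o map_poly (comp_poly 'X^d \o map_poly polyC).
have WC q : W q%:P = map_poly polyC q \Po 'X^d.
  by rewrite /W /= map_polyC /horner_eval hornerC.
rewrite -[LHS]/((W \o Phi) p); apply: eq_mpoly_rmorph => [c|i].
  by rewrite [LHS]/= [RHS]/= !mmapC -[LHS]/(W c%:MP%:P%:P) WC map_polyC comp_polyC.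
rewrite [LHS]/= [RHS]/= !mmapX !mmap1U; apply: (rmorph_coord_change (g := W)) => [x|j||].
- by rewrite -[LHS]/(W x%:MP%:P%:P) WC map_polyC comp_polyC.
- by rewrite WC map_polyC comp_polyC.
- by rewrite WC map_polyX comp_polyX.
- by rewrite /W /= map_polyX /horner_eval hornerX.
Qed.

(* Since a_i0 z^d + a_i1 = 0, the terms T^d cancel and T^(d-1) gets the coefficient b, in which
   X_i0 occurs with coefficient d a_i0 z^(d-1) <> 0. *)
Let weight_top : exists2 b : R, b != 0 &
  has_top (d * d.-1) ((a i2)%:MP *: 'X^d + b%:P) (weight_subst d (Phi f)).
Proof.
rewrite weight_subst_Phi mmap_f.
have dd1_gt0 : (0 < d.-1)%N by rewrite -subn1 subn_gt0.
(* In weight d the coordinates i0 and i1 have top coefficients z and 1, all others 0 (Y has weight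
   d-1). As deg f' <= d-1, f' reaches at most weight d (d-1). *)
have top_h i : has_top d (C (if i == i0 then z else (i == i1)%:R)) (weight_h i).
  rewrite /weight_h /coord_change; have [_|_] := eqVneq i i0.
    rewrite -[C z]addr0; apply: has_topD; last first.
      by apply: has_top_small; rewrite (leq_trans (size_polyC_leq1 _)).
    rewrite -[C z]mulr1; apply: (has_topM (has_topC (C z))).
    by split; rewrite ?size_polyXn ?coefXn ?eqxx.
  have [_|_] := eqVneq i i1; first by split; rewrite ?size_polyXn ?coefXn ?eqxx ?rmorph1.
  rewrite rmorph0; apply: has_top_small; case: eqP => _.
    rewrite mul_polyC size_scale ?polyX_eq0 // size_polyXn prednK //.
  by rewrite (leq_trans (size_polyC_leq1 _)).
have [|b] := has_top_mmap (p := f') (e := d.-1) d_gt0 _ top_h.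
  by rewrite prednK.
move=> top_f'.
pose b0 := (a i0 * z ^+ d.-1)%:MP * 'X_i0 *+ d + b%:MP : R.
exists b0.
  apply: contraTneq isT => /(congr1 (mcoeff U_(i0))).
  rewrite mcoeff0 mcoeffD mcoeffMn mcoeffCM mcoeffXU mcoeffC eqxx mulr1 mnm1_eq0 mulr0 addr0.
  move/eqP; rewrite -mulr_natr !mulf_eq0 expf_eq0 dd1_gt0 (negPf (a_neq0 _)) (negPf d_neq0) /= orbF.
  (* With z = 0 the equation for z would read a_i1 = 0. *)
  move=> /eqP z0; move: z_root; rewrite z0 expr0n gtn_eqF // mulr0 add0r => /eqP.
  by rewrite (negPf (a_neq0 _)).
rewrite /b0 polyCD addrA; apply: has_topD top_f'.
rewrite polyCMn polyCM -mul_polyC.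
apply: (has_top_diagonal (g := C) (x := weight_h) (u := ('X_i0)%:P)).
- by rewrite /weight_h /coord_change eqxx.
- by rewrite /weight_h /coord_change (negPf neq10) eqxx.
- rewrite /weight_h /coord_change (negPf neq20) (negPf neq21) eqxx.
  rewrite -[X in has_top _ X _]mulr1 -[d.-1]add0n; apply: (has_topM (has_topC 'X)).
  by rewrite add0n; split; rewrite ?size_polyXn ?coefXn ?eqxx.
move=> i /negPf neq_i0 /negPf neq_i1 /negPf neq_i2.
rewrite /weight_h /coord_change neq_i0 neq_i1 neq_i2 -polyC_exp.
exact: size_polyC_leq1.
Qed.

Let Phi_irreducible (c : {poly R}) (g h : {poly {poly R}}) :
  c != 0 -> (size g <= d)%N -> (size h <= d)%N -> c%:P * Phi f <> g * h.
Proof.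
move=> c_neq0; have [b b_neq0 top_b] := weight_top.
apply: weight_subst_irreducible top_b => //.
by rewrite mpolyC_eq0.
Qed.

Let Phi_size : size (Phi f) = d.+1 /\ lead_coef (Phi f) = C (a i2).
Proof. by apply: has_top_size Phi_top; rewrite polyC_eq0 mpolyC_eq0. Qed.

(** On the hypersurface [Phi p] agrees with its remainder r, and s is a combination of [Phi f] and
    r; so a zero of p there is a zero of s. The point x guarantees r != 0. *)
Let nonvanishing_cond p x : f.@[x] = 0 -> p.@[x] != 0 ->
  exists2 s : {poly R}, s != 0 & forall v t y,
    f.@[coord_change idfun v t y] = 0 -> (map_poly (meval v) s).[t] != 0 ->
    p.@[coord_change idfun v t y] != 0.
Proof.
move=> fx0 px0; pose F := C (a i2)^-1 *: Phi f.
have [size_f lead_f] := Phi_size.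
have F_monic : F \is monic.
  by rewrite monicE lead_coefZ lead_f -rmorphM mulVf // rmorph1.
have Phi_pE := Pdiv.RingMonic.rdivp_eq F_monic (Phi p).
set r := Pdiv.Ring.rmodp _ _ in Phi_pE; set q := Pdiv.Ring.rdivp _ _ in Phi_pE.
have evE v t y : f.@[coord_change idfun v t y] = 0 ->
    p.@[coord_change idfun v t y] = ev v t y r.
  move=> f0; rewrite -ev_Phi Phi_pE rmorphD rmorphM /F -mul_polyC [ev v t y (_ * Phi f)]rmorphM.
  by rewrite ev_Phi f0 !mulr0 add0r.
have r_neq0 : r != 0.
  apply: contraNneq px0 => r0.
  (* The inverse coordinate change, which recovers x from these parameters with t = x_i1 and y =
     x_i2. *)
  pose v i := if i == i0 then x i0 - z * x i1 else x i.
  have xE : coord_change idfun v (x i1) (x i2) =1 x.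
    move=> i; rewrite /coord_change /v eqxx addrC subrK.
    by case: eqP => [->//|_]; case: eqP => [->//|_]; case: eqP => [->|].
  by rewrite -(meval_eq _ xE) evE ?(meval_eq _ xE) // r0 rmorph0.
have size_r : (size r <= d)%N.
  rewrite -ltnS -size_f; have := Pdiv.Ring.ltn_rmodpN0 (Phi p) (monic_neq0 F_monic).
  by rewrite /F size_scale // polyC_eq0 mpolyC_eq0 invr_eq0.
have [s [U [V [s_neq0 eq_s]]]] := constant_in_ideal d_gt0 size_f r_neq0 size_r Phi_irreducible.
exists s => // v t y f0; apply: contraNneq => p0.
by rewrite -(evC v t y) eq_s rmorphD !rmorphM ev_Phi -evE // f0 p0 !mulr0 addr0.
Qed.

Let polyR_nonvanishing (s : {poly R}) :
  s != 0 -> exists v t, (map_poly (meval v) s).[t] != 0.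
Proof.
rewrite -lead_coef_eq0 => /mpoly_nonvanishing[v v_neq0]; exists v.
have /closed_nonrootP[t t_nroot] : map_poly (meval v) s != 0.
  by apply: contraNneq v_neq0 => s0; rewrite lead_coefE -coef_map s0 coef0.
by exists t.
Qed.

(** For fixed v and t the equation has degree exactly d > 0 in y, its leading coefficient being the
    constant a_i2. *)
Let fiber_point v t : exists y, f.@[coord_change idfun v t y] = 0.
Proof.
pose P := map_poly (horner_eval t \o map_poly (meval v)) (Phi f).
have [size_f lead_f] := Phi_size.
have lead_neq0 : (horner_eval t \o map_poly (meval v)) (lead_coef (Phi f)) != 0.
  by rewrite lead_f /= map_polyC /horner_eval hornerC /= mevalC.
have /closed_rootP[y /rootP y_root] : size P != 1.
  by rewrite size_map_poly_id0 // size_f eqSS -lt0n.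
by exists y; rewrite -ev_Phi.
Qed.

Lemma diagonal_hypersurface_nonempty : exists x, f.@[x] = 0.
Proof. by have [y] := fiber_point (fun=> 0) 0; eexists; eauto. Qed.

Lemma diagonal_hypersurface_irreducible p q x y :
    f.@[x] = 0 -> p.@[x] != 0 -> f.@[y] = 0 -> q.@[y] != 0 ->
  exists w, [/\ f.@[w] = 0, p.@[w] != 0 & q.@[w] != 0].
Proof.
move=> fx px fy qy.
have [s s_neq0 sP] := nonvanishing_cond fx px.
have [s' s'_neq0 s'P] := nonvanishing_cond fy qy.
(* The product is nonzero because [{poly R}] is a domain; [fiber_point] then lifts (v, t) to the
   hypersurface. *)
have [v [t]] := polyR_nonvanishing (mulf_neq0 s_neq0 s'_neq0).
rewrite rmorphM hornerM mulf_eq0 negb_or => /andP[st s't].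
have [u fu] := fiber_point v t; exists (coord_change idfun v t u).
by split; [ | apply: sP | apply: s'P].
Qed.

End DiagonalHypersurface.

(** * Finitely many coordinate values on the solutions of x_j^(e+1) = P_j(x) *)

Lemma mmap1D (n : nat) (S : comNzRingType) (x : 'I_n -> S) (m1 m2 : 'X_{1..n}) :
  mmap1 x (m1 + m2)%MM = mmap1 x m1 * mmap1 x m2.
Proof. by apply: commr_mmap1_M => i y; apply: mulrC. Qed.

Section CoordinateAnnihilator.

Variables (K : fieldType) (n e : nat) (P : 'I_n -> {mpoly K[n]}).
Hypothesis size_P : forall j, (msize (P j) <= e.+1)%N.

Let sols (x : 'I_n -> K) : Prop := forall j, x j ^+ e.+1 = (P j).@[x].

Let B := {ffun 'I_n -> 'I_e.+1}.
Let mon (k : B) : 'X_{1..n} := [multinom k j : nat | j < n].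

(** The coefficients r are common to all solutions x; this makes the multiplication matrix below
    independent of x. *)
Let spanned (phi : ('I_n -> K) -> K) : Prop :=
  exists r : B -> K, forall x, sols x -> phi x = \sum_k r k * mmap1 x (mon k).

Let spanned_lin (I : Type) (s : seq I) (c : I -> K) (phi : I -> ('I_n -> K) -> K) :
  (forall i, spanned (phi i)) -> spanned (fun x => \sum_(i <- s) c i * phi i x).
Proof.
move=> sp; elim: s => [|i s [r IHs]].
  by exists (fun=> 0) => x _; rewrite big_nil big1 // => k; rewrite mul0r.
have [r' eq_r'] := sp i; exists (fun k => c i * r' k + r k) => x Sx.
rewrite big_cons IHs // eq_r' // big_distrr -big_split /=; apply: eq_bigr => k _.
by rewrite mulrDl mulrA.
Qed.

(** By induction on the degree: if some exponent m_j exceeds e, replacing a factor x_j^(e+1) by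
    P_j(x), of degree at most e, lowers the degree. *)
Let spanned_mon m : spanned (fun x => mmap1 x m).
Proof.
have [N] := ubnP (mdeg m); elim: N m => // N IHN m; rewrite ltnS => le_mN.
have [/forallP small|/forallPn[j]] := boolP [forall j, (m j < e.+1)%N].
  exists (fun k => (k == [ffun j => Ordinal (small j)])%:R) => x _.
  rewrite (bigD1 [ffun j => Ordinal (small j)]) //= eqxx mul1r big1.
    by rewrite addr0; congr mmap1; apply/mnmP => j; rewrite mnmE ffunE.
  by move=> k /negPf->; rewrite mul0r.
rewrite -leqNgt => le_ej; pose m' := (m - U_(j) *+ e.+1)%MM.
have mE : m = (m' + U_(j) *+ e.+1)%MM.
  rewrite submK //; apply/mnm_lepP => k; rewrite mulmnE mnm1E.
  by case: eqP => [<-|_]; rewrite ?mul1n.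
(* The cut-off at 0 makes [phi m2] spanned for every m2, as [spanned_lin] asks, and changes nothing
   on the support of P_j. *)
pose phi (m2 : 'X_{1..n}) (x : 'I_n -> K) :=
  if (mdeg m2 < e.+1)%N then mmap1 x (m' + m2)%MM else 0.
have [r eq_r] : spanned (fun x => \sum_(m2 <- msupp (P j)) (P j)@_m2 * phi m2 x).
  apply: spanned_lin => m2; rewrite /phi; have [lt_m2|_] := ltnP (mdeg m2) e.+1; last first.
    by exists (fun=> 0) => x _; apply/esym/big1 => k _; rewrite mul0r.
  apply: IHN; rewrite (leq_trans _ le_mN) // mE !mdegD ltn_add2l mdegMn mdeg1.
  by rewrite mul1n.
exists r => x Sx; rewrite -eq_r // mE mmap1D /phi.
have -> : mmap1 x (U_(j) *+ e.+1)%MM = x j ^+ e.+1.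
  rewrite /mmap1 (bigD1 j) //= big1 ?mulr1 => [|k neq_kj].
    by rewrite mulmnE mnm1E eqxx mul1n.
  by rewrite mulmnE mnm1E eq_sym (negPf neq_kj).
rewrite Sx mevalE big_distrr /= !big_seq; apply: eq_bigr => m2 /msize_mdeg_lt lt_m2.
by rewrite (leq_trans lt_m2) // mmap1D mulrCA.
Qed.

(** At each solution x the row vector of the reduced monomials is an eigenvector of one fixed matrix
    M, with eigenvalue x_i; q is the characteristic polynomial of M. *)
Lemma coordinate_annihilator (i : 'I_n) :
  exists2 q : {poly K}, q != 0 & forall x, sols x -> root q (x i).
Proof.
have /fin_all_exists[A eq_A] : forall k : B, exists r : B -> K,
    forall x, sols x -> x i * mmap1 x (mon k) = \sum_l r l * mmap1 x (mon l).
  move=> k; have [r eq_r] := spanned_mon (U_(i) + mon k)%MM; exists r => x Sx.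
  by rewrite -eq_r // mmap1D mmap1U.
pose M := \matrix_(l < #|B|, k < #|B|) A (enum_val k) (enum_val l).
exists (char_poly M); first exact: monic_neq0 (char_poly_monic M).
move=> x Sx; rewrite -eigenvalue_root_char; apply/eigenvalueP.
exists (\row_l mmap1 x (mon (enum_val l))).
  apply/rowP => k; rewrite !mxE eq_A //; rewrite (reindex _ (onW_bij _ (enum_val_bij B))).
  by apply: eq_bigr => l _; rewrite !mxE mulrC.
(* The eigenvector is nonzero: its entry at the monomial 1 equals 1. *)
apply/eqP => /rowP /(_ (enum_rank [ffun=> ord0])); rewrite !mxE enum_rankK.
move/eqP; rewrite /mmap1 big1 ?oner_eq0 // => j _.
by rewrite mnmE ffunE.
Qed.

End CoordinateAnnihilator.

(** * Dimension of the singular locus *)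

Section ProjectiveDimension.

Variables (K : closedFieldType) (n : nat).
Implicit Types (L : proj_space K n) (X : set (proj_space K n)).

Lemma proj_spaceP L : exists2 u : 'rV[K]_n.+1, u \in val L &
  forall v, v \in val L -> exists c, v = c *: u.
Proof.
case: L => L /= /eqP dimL; exists (vpick L); first exact: memv_pick.
have pick_neq0 : vpick L != 0 by rewrite vpick0 -dimv_eq0 dimL.
move=> v; suff {1}-> : L = <[vpick L]>%VS by move/vlineP.
by apply/eqP; rewrite eq_sym eqEdim -memvE memv_pick dimL dim_vline pick_neq0.
Qed.

Let linear_form (i : 'I_n) (z : K) : {mpoly K[n.+1]} :=
  'X_(lift ord0 i) - z *: 'X_ord0.

Let linear_formE i z (v : 'rV[K]_n.+1) :
  (linear_form i z).@[fun j => v 0 j] = v 0 (lift ord0 i) - z * v 0 ord0.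
Proof. by rewrite mevalB mevalZ !mevalXU. Qed.

Let linear_form_homog i z : linear_form i z \is 1.-homog.
Proof.
by apply: rpredB; last apply: rpredZ; rewrite dhomogX /= mdeg1.
Qed.

Let prod_linear_form_homog i (s : seq K) :
  \prod_(z <- s) linear_form i z \is (size s).-homog.
Proof.
elim: s => [|z s IHs]; first by rewrite big_nil dhomog1.
by rewrite big_cons; apply: (dhomogM (linear_form_homog i z) IHs).
Qed.

(** The hyperplanes X_i = z X_0 with z in s cover X. Induction on s splits off one hyperplane
    against the zeros of the product of the other linear forms, and irreducibility selects one
    side. *)
Lemma irreducible_coord_eq X (i : 'I_n) (s : seq K) :
    irreducible_set (@proj_zariski_closed K n) X ->
    (forall L, X L -> exists2 z, z \in s &
      forall v, v \in val L -> v 0 (lift ord0 i) = z * v 0 ord0) ->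
  exists z, forall L, X L ->
    forall v, v \in val L -> v 0 (lift ord0 i) = z * v 0 ord0.
Proof.
case=> -[L0 X_L0] irrX; elim: s => [|z s IHs] Xs.
  by have [z] := Xs L0 X_L0; rewrite in_nil.
pose zeros (p : {mpoly K[n.+1]}) : set (proj_space K n) := [set L | vanishes_at p L]%classic.
have zeros_closed p e : p \is e.-homog -> proj_zariski_closed (zeros p).
  move=> p_homog; exists [set p]%classic; first by move=> _ ->; exists e.
  by apply/seteqP; split=> L; [move=> pL _ -> | apply].
pose A := (X `&` zeros (linear_form i z))%classic.
pose B := (X `&` zeros (\prod_(z <- s) linear_form i z))%classic.
have XAB : X = (A `|` B)%classic.
  apply/seteqP; split=> [L XL|L [[]|[]] //].
  have [z' + zL] := Xs L XL; rewrite inE => /predU1P[eq_z|z'_s].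
    by left; split=> // v vL; rewrite linear_formE zL // eq_z subrr.
  right; split=> // v vL; rewrite (big_rem z') //= mevalM linear_formE zL //.
  by rewrite subrr mul0r.
have closedA : closed_in (@proj_zariski_closed K n) X A.
  by exists (zeros (linear_form i z)) => //; apply: zeros_closed (linear_form_homog i z).
have closedB : closed_in (@proj_zariski_closed K n) X B.
  exists (zeros (\prod_(z <- s) linear_form i z)) => //.
  exact: zeros_closed (prod_linear_form_homog i s).
case: (irrX A B closedA closedB XAB) => [XA|XB].
  exists z => L; rewrite XA => -[_ zL] v /zL /eqP.
  by rewrite linear_formE subr_eq0 => /eqP.
apply: IHs => L; rewrite XB => -[_ sL].
(* The factor that vanishes may depend on the vector; it is chosen at a generator u and carried to
   the whole line by scaling. *)
have [u uL genL] := proj_spaceP L.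
have /eqP := sL u uL; rewrite (rmorph_prod (meval _)) /= prodf_seq_eq0.
case/hasP => z' z'_s /=; rewrite linear_formE subr_eq0 => /eqP zu.
by exists z' => // v /genL[c ->]; rewrite !mxE zu mulrCA.
Qed.

(** In a chain of length at least 1, each affine coordinate takes values on Z_1 among the roots of
    q_i, so it is constant by irreducibility. Then Z_1 is a single point, equal to its nonempty
    subset Z_0. *)
Lemma dim_le0_affine X (q : 'I_n -> {poly K}) :
    (forall i, q i != 0) ->
    (forall L v, X L -> v \in val L -> v 0 ord0 = 0 -> v = 0) ->
    (forall L v i, X L -> v \in val L -> v 0 ord0 = 1 ->
      root (q i) (v 0 (lift ord0 i))) ->
  dim_le (@proj_zariski_closed K n) X 0.
Proof.
move=> q_neq0 X_affine X_root [//|m] Z irrZ ltZ; exfalso.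
have [[C _ Z1E] irrZ1] := irrZ (lift ord0 ord0).
have [_ [[L0 Z0L0] _]] := irrZ ord0.
have [subZ nsubZ] := ltZ ord0 (lift ord0 ord0) isT.
set Z1 := Z (lift ord0 ord0) in Z1E irrZ1 subZ nsubZ.
have Z1X L : Z1 L -> X L by rewrite Z1E => -[].
have /fin_all_exists[r rP] : forall i : 'I_n, exists z, forall L, Z1 L ->
    forall v, v \in val L -> v 0 (lift ord0 i) = z * v 0 ord0.
  move=> i; have [s qE] := closed_field_poly_normal (q i).
  apply: (irreducible_coord_eq (s := s)) => // L Z1L.
  have [u uL genL] := proj_spaceP L.
  have u0_neq0 : u 0 ord0 != 0.
    apply/eqP => /(X_affine L u (Z1X L Z1L) uL) u0.
    have := valP L; suff -> : val L = 0%VS by rewrite dimv0.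
    apply/eqP; rewrite -subv0; apply/subvP => v /genL[c ->].
    by rewrite u0 scaler0 mem0v.
  exists (u 0 (lift ord0 i) / u 0 ord0); last first.
    by move=> v /genL[c ->]; rewrite !mxE mulrCA divfK.
  have := X_root L ((u 0 ord0)^-1 *: u) i (Z1X L Z1L) (memvZ _ uL).
  rewrite !mxE mulVf // => /(_ erefl).
  by rewrite qE rootZ ?lead_coef_eq0 // root_prod_XsubC mulrC.
pose w : 'rV[K]_n.+1 := \row_j if unlift ord0 j is Some i then r i else 1.
have lineE L : Z1 L -> val L = <[w]>%VS.
  move=> Z1L; apply/eqP; rewrite eqEdim (eqP (valP L)).
  rewrite dim_vline leq_b1 andbT; apply/subvP => v vL; apply/vlineP.
  exists (v 0 ord0); apply/rowP => j; rewrite !mxE.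
  by case: unliftP => [i ->|->]; rewrite ?mulr1 // (rP i L) // mulrC.
apply: nsubZ => L Z1L; suff -> : L = L0 by [].
by apply: val_inj; rewrite !lineE //; apply: subZ.
Qed.

End ProjectiveDimension.

(** * Degrees, sums over supports and derivatives of the homogenization *)

Lemma msize_leP (n k : nat) (R : nzRingType) (p : {mpoly R[n]}) :
  (forall m, (k <= mdeg m)%N -> p@_m = 0) <-> (msize p <= k)%N.
Proof.
split=> [p0|le_pk m le_km]; last first.
  by apply/memN_msupp_eq0/msize_mdeg_ge/(leq_trans le_pk).
rewrite msizeE; apply/bigmax_leqP_seq => m; rewrite mcoeff_msupp => pm_neq0 _.
by rewrite ltnNge; apply: contraNN pm_neq0 => /p0->.
Qed.

Section SumOverSupport.

Variables (R : idomainType) (n : nat) (W : 'X_{1..n} -> R).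

(** For fixed W such a sum is additive in p, although supports are not. This separates the diagonal
    part from f' in the derivatives of the homogenization, once the degree entering the weights is
    known. *)
Let pairing (p : {mpoly R[n]}) : R := \sum_(m <- msupp p) p@_m * W m.

Let pairingE s p : uniq s -> {subset msupp p <= s} ->
  pairing p = \sum_(m <- s) p@_m * W m.
Proof.
move=> s_uniq sub_s; rewrite (bigID (mem (msupp p))) /= [X in _ + X]big1 ?addr0.
  rewrite -big_filter; apply/perm_big/uniq_perm; rewrite ?filter_uniq //.
  by move=> m; rewrite mem_filter andb_idr //; apply: sub_s.
by move=> m /memN_msupp_eq0->; rewrite mul0r.
Qed.

Lemma sum_msuppD (p q : {mpoly R[n]}) :
  \sum_(m <- msupp (p + q)) (p + q)@_m * W m =
  \sum_(m <- msupp p) p@_m * W m + \sum_(m <- msupp q) q@_m * W m.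
Proof.
pose s := undup (msupp p ++ msupp q).
rewrite -!/(pairing _) !(@pairingE s) ?undup_uniq //.
- by rewrite -big_split; apply: eq_bigr => m _; rewrite mcoeffD mulrDl.
- by move=> m m_q; rewrite mem_undup mem_cat m_q orbT.
- by move=> m m_p; rewrite mem_undup mem_cat m_p.
- by move=> m /msuppD_le; rewrite mem_undup.
Qed.

Lemma sum_msuppZX (c : R) m :
  \sum_(m' <- msupp (c *: 'X_[m])) (c *: 'X_[m])@_m' * W m' = c * W m.
Proof.
have [->|c_neq0] := eqVneq c 0; first by rewrite scale0r msupp0 big_nil mul0r.
rewrite (perm_big _ (msuppZ _ c_neq0)) msuppX big_seq1.
by rewrite mcoeffZ mcoeffX eqxx mulr1.
Qed.

Lemma sum_msupp_diagonal (d : nat) (a : 'I_n -> R) (f' : {mpoly R[n]}) :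
  \sum_(m <- msupp (\sum_i a i *: 'X_i ^+ d + f'))
     (\sum_i a i *: 'X_i ^+ d + f')@_m * W m =
  \sum_i a i * W (U_(i) *+ d)%MM + \sum_(m <- msupp f') f'@_m * W m.
Proof.
rewrite sum_msuppD; congr (_ + _); rewrite -/(pairing _).
rewrite (big_morph pairing sum_msuppD (id1 := 0)) /pairing ?msupp0 ?big_nil //.
by apply: eq_bigr => i _; rewrite mpolyXn sum_msuppZX.
Qed.

End SumOverSupport.

Lemma mderiv_homogenization (K : fieldType) (n : nat) (f : {mpoly K[n]}) (i : 'I_n)
    (v : 'I_n.+1 -> K) :
  ((homogenization f)^`M(lift ord0 i)).@[v] = \sum_(m <- msupp f)
    f@_m * ((m i)%:R * v ord0 ^+ ((msize f).-1 - mdeg m)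
            * mmap1 (v \o lift ord0) (m - U_(i))%MM).
Proof.
rewrite /homogenization (linear_sum (mderiv (lift ord0 i))) (raddf_sum (meval v)) /=.
apply: eq_bigr => m _.
rewrite mderivZ mevalZ; congr (_ * _); set k := (_ - _)%N.
pose hm := [multinom if unlift ord0 j is Some j' then m j' else k | j < n.+1].
have -> : 'X_ord0 ^+ k * \prod_(j < n) 'X_(lift ord0 j) ^+ m j = 'X_[hm] :> {mpoly K[n.+1]}.
  rewrite [RHS]mpolyXE_id [RHS]big_ord_recl mnmE unlift_none; congr (_ * _).
  by apply: eq_bigr => j _; rewrite mnmE liftK.
rewrite mderivX mevalZ mevalX big_ord_recl mulrA.
rewrite mnmBE mnm1E /hm !mnmE unlift_none liftK subn0; congr (_ * _).
apply: eq_bigr => j _; rewrite !mnmBE !mnm1E mnmE liftK /=.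
by rewrite (inj_eq lift_inj).
Qed.

(** The pure powers X_i^d are distinct monomials because d > 0, and f' has no term of degree d; so
    the coefficient a_i0 survives. *)
Lemma msize_diagonal (K : fieldType) (n d : nat) (a : 'I_n -> K) (f' : {mpoly K[n]}) :
    (0 < n)%N -> (0 < d)%N -> (forall i, a i != 0) -> (msize f' <= d)%N ->
  msize (\sum_i a i *: 'X_i ^+ d + f') = d.+1.
Proof.
move=> n_gt0 d_gt0 a_neq0 /msize_leP f'0; pose i0 := Ordinal n_gt0.
have coefE m : (d <= mdeg m)%N ->
    (\sum_i a i *: 'X_i ^+ d + f')@_m = \sum_i a i * ((U_(i) *+ d)%MM == m)%:R.
  move=> le_dm; rewrite mcoeffD f'0 // addr0 raddf_sum; apply: eq_bigr => i _.
  by rewrite /= mcoeffZ mcoeffXn.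
have mdegUd (i : 'I_n) : mdeg (U_(i) *+ d)%MM = d by rewrite mdegMn mdeg1 mul1n.
apply/eqP; rewrite eqn_leq; apply/andP; split.
  apply/msize_leP => m lt_dm; rewrite coefE 1?ltnW // big1 // => i _.
  by case: eqP lt_dm => [<-|_ _]; rewrite ?mdegUd ?ltnn ?mulr0.
rewrite -[X in (X < _)%N](mdegUd i0); apply: msize_mdeg_lt.
rewrite mcoeff_msupp coefE; last by rewrite mdegUd.
rewrite (bigD1 i0) //= eqxx mulr1 big1 ?addr0 // => i neq_i.
case: eqP => [/mnmP/(_ i0)|_]; last by rewrite mulr0.
rewrite !mulmnE !mnm1E eqxx (negPf neq_i) mul0n mul1n => d0.
by rewrite -d0 in d_gt0.
Qed.

(** * The singular locus of the projective closure *)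

Section SingularLocus.

Variables (K : closedFieldType) (n d : nat) (a : 'I_n -> K) (f' : {mpoly K[n]}).
Hypotheses (n_gt0 : (0 < n)%N) (d_neq0 : d.+2%:R != 0 :> K).
Hypotheses (a_neq0 : forall i, a i != 0) (size_f' : (msize f' <= d.+2)%N).

(** The degree is written [d.+2], so that the derivatives carry the exponent [d.+1] and the reduced
    monomials have exponents at most d. *)
Let f : {mpoly K[n]} := \sum_i a i *: 'X_i ^+ d.+2 + f'.

Let partial i (v : 'I_n.+1 -> K) :
  ((homogenization f)^`M(lift ord0 i)).@[v] =
    a i * (d.+2%:R * v (lift ord0 i) ^+ d.+1)
    + \sum_(m <- msupp f') f'@_m * ((m i)%:R * v ord0 ^+ (d.+2 - mdeg m)
        * mmap1 (v \o lift ord0) (m - U_(i))%MM).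
Proof.
rewrite mderiv_homogenization msize_diagonal // sum_msupp_diagonal; congr (_ + _).
rewrite (bigD1 i) //= big1 ?addr0 => [|j neq_ji]; last first.
  by rewrite mulmnE mnm1E (negPf neq_ji) mul0n !mul0r mulr0.
rewrite mulmnE mnm1E eqxx mul1n mdegMn mdeg1 mul1n subnn expr0 mulr1.
congr (_ * (_ * _)); rewrite /mmap1 (bigD1 i) //= big1 ?mulr1 => [|j neq_ji].
  by rewrite mnmBE mulmnE mnm1E eqxx mul1n subn1.
by rewrite mnmBE mulmnE mnm1E eq_sym (negPf neq_ji).
Qed.

Lemma singular_locus_affine L v : singular_locus (homogenization f) L ->
  v \in val L -> v 0 ord0 = 0 -> v = 0.
Proof.
move=> [_ singL] vL v0; apply/rowP => j; rewrite mxE.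
case: (unliftP ord0 j) => [i ->|-> //].
have := singL (lift ord0 i) v vL; rewrite partial big_seq big1 ?addr0.
  move/eqP; rewrite !mulf_eq0 (negPf (a_neq0 i)) (negPf d_neq0) expf_eq0 /=.
  by move/eqP.
(* Monomials of f' have degree below [d.+2], so X_0 keeps a positive exponent and each term vanishes
   at X_0 = 0. *)
move=> m /msize_mdeg_lt lt_m; rewrite v0 expr0n subn_eq0 leqNgt.
by rewrite (leq_trans lt_m) // mulr0 mul0r mulr0.
Qed.

Lemma singular_locus_dim :
  dim_le (@proj_zariski_closed K n) (singular_locus (homogenization f)) 0.
Proof.
(* On X_0 = 1, the vanishing of the i-th partial derivative is solved for x_i^(d+1); the right-hand
   side has degree at most d. *)
pose P i := - (a i * d.+2%:R)^-1 *: f'^`M(i).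
have size_P i : (msize (P i) <= d.+1)%N.
  apply/msize_leP => m le_dm; rewrite mcoeffZ mcoeff_deriv.
  move/msize_leP: size_f' => ->; first by rewrite mul0rn mulr0.
  by rewrite mdegD mdeg1 addn1.
have /fin_all_exists2[q q_neq0 qP] := coordinate_annihilator size_P.
apply: (dim_le0_affine q_neq0 singular_locus_affine).
move=> L v i [_ singL] vL v0.
apply: (qP i (fun j => v 0 (lift ord0 j))) => j.
have := singL (lift ord0 j) v vL; rewrite partial mevalZ.
have -> : (f'^`M(j)).@[fun j => v 0 (lift ord0 j)] =
    \sum_(m <- msupp f') f'@_m * ((m j)%:R * v 0 ord0 ^+ (d.+2 - mdeg m)
      * mmap1 ((fun j => v 0 j) \o lift ord0) (m - U_(j))%MM).
  rewrite {1}[f']mpolyE (linear_sum (mderiv j)) (raddf_sum (meval _)) /=.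
  apply: eq_bigr => m _; rewrite mderivZ mderivX !mevalZ mevalX v0 expr1n mulr1.
  by rewrite mulrA.
move/eqP; rewrite mulrA addr_eq0 => /eqP eq_v.
have ad_neq0 : a j * d.+2%:R != 0 by rewrite mulf_neq0.
by apply: (mulfI ad_neq0); rewrite eq_v mulNr mulrN mulVKf.
Qed.

End SingularLocus.

(** * Irreducibility of the affine hypersurface as a closed set *)

(** If V were the union of proper closed subsets A and B, some p would vanish on A and some q on B,
    neither on all of V; a point of V where both are nonzero lies in neither subset. *)
Lemma affine_hypersurface_irreducible (K : fieldType) (n : nat) (f : {mpoly K[n]}) :
    (exists x, f.@[x] = 0) ->
    (forall p q x y, f.@[x] = 0 -> p.@[x] != 0 -> f.@[y] = 0 -> q.@[y] != 0 ->
      exists w, [/\ f.@[w] = 0, p.@[w] != 0 & q.@[w] != 0]) ->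
  irreducible_set (@affine_zariski_closed K n)
    [set x : affine_space K n | f.@[fun i => x 0 i] = 0]%classic.
Proof.
set V := [set x | _]%classic => -[x0 fx0] f_irr.
have Vrow x : f.@[x] = 0 -> V (\row_i x i).
  by rewrite /V /= => <-; apply: meval_eq => i; rewrite mxE.
split; first by exists (\row_i x0 i); apply: Vrow.
have notV A : closed_in (@affine_zariski_closed K n) V A -> V <> A ->
    exists p, (exists2 x : 'rV_n, V x & p.@[fun i => x 0 i] != 0) /\
      forall x, A x -> p.@[fun i => x 0 i] = 0.
  move=> [C [S ->] ->] neqV.
  have [//|noP] := pselect (exists p, (exists2 x : 'rV_n, V x & p.@[fun i => x 0 i] != 0) /\ S p).
    by move=> [p [[x Vx px] Sp]]; exists p; split; [exists x | move=> y [_ ]; apply].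
  case: neqV; apply/seteqP; split=> x; last by case.
  move=> Vx; split=> // p Sp; apply/eqP; apply: contra_notT noP => px.
  by exists p; split=> //; exists x.
move=> A B closedA closedB VAB.
have [VA|/(notV A closedA)[p [[x Vx px] pA]]] := pselect (V = A); first by left.
have [VB|/(notV B closedB)[q [[y Vy qy] qB]]] := pselect (V = B); first by right.
have [w [fw pw qw]] := f_irr p q _ _ Vx px Vy qy; exfalso.
have eval_row r : r.@[fun i => (\row_i w i) 0 i] = r.@[w].
  by apply: meval_eq => i; rewrite mxE.
have := Vrow w fw; rewrite VAB => -[/pA|/qB] /eqP; rewrite eval_row.
  by rewrite (negPf pw).
by rewrite (negPf qw).
Qed.

Lemma diagonal_irreducible_set (K : closedFieldType) (n d : nat) (a : 'I_n -> K)
    (f' : {mpoly K[n]}) :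
    (3 <= n)%N -> (2 <= d)%N -> d%:R != 0 :> K -> (forall i, a i != 0) ->
    (msize f' <= d)%N ->
  irreducible_set (@affine_zariski_closed K n)
    [set x : affine_space K n |
      (\sum_i a i *: 'X_i ^+ d + f').@[fun i => x 0 i] = 0]%classic.
Proof.
move=> n_ge3 d_ge2 d_neq0 a_neq0 size_f'.
pose i0 := Ordinal (leq_trans (isT : 0 < 3)%N n_ge3).
pose i1 := Ordinal (leq_trans (isT : 1 < 3)%N n_ge3).
pose i2 := Ordinal (leq_trans (isT : 2 < 3)%N n_ge3).
have [neq10 neq20 neq21] : [/\ i1 != i0, i2 != i0 & i2 != i1] by [].
have [z z_root] : exists z, a i0 * z ^+ d + a i1 = 0.
  have /closed_rootP[z /eqP] : size (a i0 *: 'X^d + (a i1)%:P) != 1%N.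
    have size_X : size (a i0 *: 'X^d) = d.+1 by rewrite size_scale // size_polyXn.
    rewrite size_polyDl size_X; last by rewrite size_polyC a_neq0 ltnS ltnW.
    by rewrite eqSS -lt0n ltnW.
  by rewrite !hornerE; exists z.
apply: affine_hypersurface_irreducible.
  exact: (diagonal_hypersurface_nonempty d_ge2 a_neq0 size_f' z neq20 neq21).
exact: (diagonal_hypersurface_irreducible d_ge2 d_neq0 a_neq0 size_f' neq10 neq20 neq21 z_root).
Qed.

(** * The polynomial of [Vg] and the conclusion *)

Lemma Vg_poly_diagonal (F K : fieldType) (iota : {rmorphism F -> K}) (n d : nat)
    (h : 'I_n -> {poly F}) (g : {mpoly F[n]}) :
    (forall i, size (h i) = d.+1) -> (msize g <= d)%N ->
  exists2 f' : {mpoly K[n]}, (msize f' <= d)%N &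
    map_mpoly iota (Vg_poly h g) = \sum_i iota (h i)`_d *: 'X_i ^+ d + f'.
Proof.
move=> size_h size_g.
(* The terms of the h_i below degree d, together with -g. *)
pose f' := \sum_i \sum_(j < d) iota (h i)`_j *: 'X_i ^+ j - map_mpoly iota g.
exists f'.
  apply/msize_leP => m le_dm; rewrite mcoeffB mcoeff_map_mpoly.
  move/msize_leP: size_g => -> //; rewrite raddf0 subr0 raddf_sum big1 //= => i _.
  rewrite raddf_sum big1 //= => j _; rewrite mcoeffZ mcoeffXn.
  case: eqP => [eq_m|_]; last by rewrite mulr0.
  by move: le_dm; rewrite -eq_m mdegMn mdeg1 mul1n leqNgt ltn_ord.
rewrite /Vg_poly (rmorphB (map_mpoly iota)) /f' addrA; congr (_ - _).
rewrite (rmorph_sum (map_mpoly iota)) -big_split; apply: eq_bigr => i _ /=.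
rewrite (@horner_coef_wide _ d.+1) ?(leq_trans (size_poly _ _)) ?size_h //.
rewrite (rmorph_sum (map_mpoly iota)) big_ord_recr addrC /=.
congr (_ + _); first apply: eq_bigr => j _;
  by rewrite coef_map_id0 ?mpolyC0 // (rmorphM (map_mpoly iota)) rmorphXn /=
    map_mpolyC map_mpolyX mul_mpolyC.
Qed.

(* (K, iota) is an algebraic closure of the finite field F. *)
Theorem theorem4p11 (F : finFieldType) (K : closedFieldType)
    (iota : {rmorphism F -> K}) (K_alg : integralRange iota)
    (n d : nat) (n_ge3 : (3 <= n)%N) (d_ge2 : (2 <= d)%N)
    (char_ndvd_d : forall p, p \in [pchar F] -> ~~ (p %| d)%N)
    (h : 'I_n -> {poly F}) (deg_h : forall i, size (h i) = d.+1)
    (g : {mpoly F[n]}) (deg_g : ((msize g).-1 < d)%N) :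
  dim_le (@proj_zariski_closed K n) (singular_locus (pcl_Vg_poly iota h g)) 0 /\
  irreducible_set (@affine_zariski_closed K n) (Vg iota h g).
Proof.
have d_gt0 : (0 < d)%N := ltnW d_ge2.
have d_neq0 : d%:R != 0 :> K.
  rewrite -(rmorph_nat iota) fmorph_eq0 natf_neq0_pchar; apply/pnatP => // p _ p_dvd.
  by apply/negP => /char_ndvd_d; rewrite p_dvd.
(* The bound [msize g <= d] follows from [deg_g] also when g = 0, where [msize g] and its
   predecessor are both 0. *)
have [f' size_f' fE] := Vg_poly_diagonal iota deg_h (leq_trans (leqSpred _) deg_g).
have lead_neq0 i : iota (h i)`_d != 0.
  by rewrite fmorph_eq0 -[d]/(d.+1.-1) -(deg_h i) -lead_coefE lead_coef_eq0 -size_poly_gt0 deg_h.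
split.
  rewrite /pcl_Vg_poly fE.
  case: d d_ge2 d_neq0 size_f' lead_neq0 {fE d_gt0 char_ndvd_d deg_h deg_g} => [|[|d]] // _.
  by move=> *; apply: singular_locus_dim => //; apply: leq_trans n_ge3.
by rewrite VgE fE; apply: diagonal_irreducible_set.
Qed.
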